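(* Let $\mathbb{F}\in\{\mathbb{R},\mathbb{C}\}$ and let $r$ be a positive integer, with $r$ even if $\mathbb{F}=\mathbb{R}$. Let $m=2^r$ and let $\{\mathcal{B}_k\}_{k\in K}$ be a maximal collection of mutually unbiased bases for $\mathbb{F}^m$, so $|K|=k_{\mathbb{F}}(m)$. Then $$\mathcal{F}=\{P^{(k)}_{\mathcal{J}}: k\in K,\ \mathcal{J}\in\mathbb{S}_r\}$$ is a tight, maximal orthoplectic fusion frame, where $P^{(k)}_{\mathcal{J}}$ denotes the $\mathcal{J}$-coordinate projection with respect to $\mathcal{B}_k$.
   Context: Define $\{0,1\}$-matrices $S_r$ recursively: $S_1=I_2$; for $r\ge1$, $F_r=I_{2^r-1}\otimes\begin{pmatrix}0&1\\1&0\end{pmatrix}$, and $1_r$, $0_r$ are the $2^r\times1$ all-ones and all-zeros column vectors; for $r\ge2$, $S_r=\big(B_r^{(i)}\ B_r^{(ii)}\ B_r^{(iii)}\big)$ with $B_r^{(i)}=\begin{pmatrix}1_{r-1}&0_{r-1}\\0_{r-1}&1_{r-1}\end{pmatrix}$, $B_r^{(ii)}=\begin{pmatrix}S_{r-1}\\S_{r-1}\end{pmatrix}$, $B_r^{(iii)}=\begin{pmatrix}S_{r-1}\\S_{r-1}F_{r-1}\end{pmatrix}$. $S_r$ is $2^r\times(2^{r+1}-2)$, and $\mathbb{S}_r$ is the collection of blocks $\mathcal{J}_b=\{a:(S_r)_{a,b}=1\}\subset\{1,\dots,2^r\}$, one for each column $b$. Orthonormal bases $\{b_j\},\{b'_j\}$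 of $\mathbb{F}^m$ are mutually unbiased if $|\langle b_j,b'_{j'}\rangle|^2=1/m$ for all $j,j'$; a collection of pairwise mutually unbiased bases is maximal if it has $k_{\mathbb{F}}(m)$ elements, where $k_{\mathbb{R}}(m)=m/2+1$, $k_{\mathbb{C}}(m)=m+1$. The $\mathcal{J}$-coordinate projection with respect to $\{b_j\}$ is $\sum_{j\in\mathcal{J}}b_j\otimes b_j^*$. An $(n,l,m)$-fusion frame is a set $\{P_j\}_{j=1}^n$ of orthogonal projections onto $l$-dimensional subspaces of $\mathbb{F}^m$ with $A\|x\|^2\le\sum_j\|P_jx\|^2\le B\|x\|^2$ for some $0<A\le B$ and all $x$; it is tight if one can take $A=B$. Let $d_{\mathbb{F}}(m)=\frac{(m+2)(m-1)}{2}$ if $\mathbb{F}=\mathbb{R}$ and $m^2-1$ if $\mathbb{F}=\mathbb{C}$. A fusion frame is Grassmannian if it minimizes $\max_{j\ne k}\mathrm{tr}(P_jP_k)$ among all $(n,l,m)$-fusion frames; orthoplex-bound achieving if Grassmannian, $n>d_{\mathbb{F}}(m)+1$ and $\max_{j\ne k}\mathrm{tr}(P_jP_k)=l^2/m$; maximal orthoplectic if orthoplex-bound achieving with $n=2d_{\mathbb{F}}(m)$. *)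

(* Defs.v *)
From HB Require Import structures.
From mathcomp Require Import all_boot all_order all_algebra.
From mathcomp Require Import complex.
From mathcomp Require Import reals.
Set Implicit Arguments. Unset Strict Implicit. Unset Printing Implicit Defensive.
Import Order.TTheory GRing.Theory Num.Theory.
Local Open Scope ring_scope.

(* F_r = I_(2^r - 1) \otimes [[0,1],[1,0]], a (2^(r+1)-2) x (2^(r+1)-2) matrix:
   Kronecker indexing k = 2*k1 + k2, so (F_r)_{k,j} = [k1 = j1] * [k2 <> j2]. *)
Definition Fent (r k j : nat) : nat :=
  ((k./2 == j./2) && (odd k != odd j))%N.

(* Sent r a b = (S_r)_{a,b}, for a < 2^r, b < 2^(r+1) - 2. *)
Fixpoint Sent (r : nat) : nat -> nat -> nat :=
  match r with
  | 0 => fun _ _ => 0%N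
  | r'.+1 =>
    if r' == 0%N then fun a b => (a == b : nat)
    else fun a b =>
      let h := (2 ^ r')%N in            (* rows of S_(r-1) *)
      let c := (2 ^ r'.+1 - 2)%N in     (* columns of S_(r-1) *)
      if (b < 2)%N then
        (if (a < h)%N then (b == 0%N : nat) else (b == 1%N : nat))
      else if (b < 2 + c)%N then        (* block B^(ii) = (S_(r-1); S_(r-1)) *)
        (if (a < h)%N then Sent r' a (b - 2) else Sent r' (a - h) (b - 2))
      else                              (* block B^(iii) = (S_(r-1); S_(r-1) F_(r-1)) *)
        let j := (b - 2 - c)%N in
        if (a < h)%N then Sent r' a j
        else (\sum_(k < c) Sent r' (a - h) k * Fent r' k j)%N
  end.

Definition Jblock (r : nat) (b : 'I_(2 ^ r.+1 - 2)) : {set 'I_(2 ^ r)} :=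
  [set a : 'I_(2 ^ r) | Sent r a b == 1%N].

Section LinAlg.
Variable R : realType.
Local Notation C := R[i].

(* isC = true : F = C ;  isC = false : F = R (vectors/matrices with real entries) *)
Definition inF (isC : bool) (x : C) : bool := isC || (x \is Num.real).
Definition vecF isC m (x : 'cV[C]_m) : bool := [forall i, inF isC (x i 0)].
Definition matF isC m (A : 'M[C]_m) : bool := [forall i, forall j, inF isC (A i j)].

Definition cdot m (x y : 'cV[C]_m) : C := \sum_(i < m) x i 0 * (y i 0)^*.
Definition nrm2 m (x : 'cV[C]_m) : C := cdot x x.
Definition adj m n (A : 'M[C]_(m, n)) : 'M[C]_(n, m) := (map_mx Num.conj A)^T.

Definition kF (isC : bool) (m : nat) : nat := if isC then m.+1 else (m %/ 2).+1.
Definition dF (isC : bool) (m : nat) : nat :=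
  if isC then (m ^ 2 - 1)%N else ((m + 2) * (m - 1) %/ 2)%N.

Definition orthonormal_basis isC m (b : 'I_m -> 'cV[C]_m) : Prop :=
  (forall j, vecF isC (b j)) /\
  (forall j j', cdot (b j) (b j') = (j == j')%:R).

Definition mutually_unbiased m (b b' : 'I_m -> 'cV[C]_m) : Prop :=
  forall j j', `|cdot (b j) (b' j')| ^+ 2 = m%:R^-1.

Definition maximal_MUB isC m (K : finType) (B : K -> 'I_m -> 'cV[C]_m) : Prop :=
  [/\ #|K| = kF isC m,
      (forall k, orthonormal_basis isC (B k)) &
      (forall k k', k != k' -> mutually_unbiased (B k) (B k'))].

Definition coord_proj m (b : 'I_m -> 'cV[C]_m) (J : {set 'I_m}) : 'M[C]_m :=
  \sum_(j in J) (b j *m adj (b j)).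

Definition orth_proj isC m l (P : 'M[C]_m) : Prop :=
  [/\ matF isC P, P *m P = P, adj P = P & \rank P = l].

Definition fusion_frame isC m l (I : finType) (P : I -> 'M[C]_m) : Prop :=
  (forall j, orth_proj isC l (P j)) /\
  exists A B : C, [/\ 0 < A, A <= B &
    forall x : 'cV[C]_m, vecF isC x ->
      A * nrm2 x <= \sum_j nrm2 (P j *m x) <= B * nrm2 x].

Definition tight_fusion_frame isC m l (I : finType) (P : I -> 'M[C]_m) : Prop :=
  fusion_frame isC l P /\
  exists A : C, 0 < A /\
    forall x : 'cV[C]_m, vecF isC x -> \sum_j nrm2 (P j *m x) = A * nrm2 x.

Definition max_corr m (I : finType) (P : I -> 'M[C]_m) : C :=
  \big[Num.max/0]_(p : I * I | p.1 != p.2) \tr (P p.1 *m P p.2).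

Definition grassmannian isC m l (I : finType) (P : I -> 'M[C]_m) : Prop :=
  fusion_frame isC l P /\
  forall Q : 'I_#|I| -> 'M[C]_m, fusion_frame isC l Q -> max_corr P <= max_corr Q.

Definition orthoplex_bound_achieving isC m l (I : finType) (P : I -> 'M[C]_m) : Prop :=
  [/\ grassmannian isC l P, (dF isC m + 1 < #|I|)%N &
      max_corr P = (l ^ 2)%:R / m%:R].

Definition maximal_orthoplectic isC m l (I : finType) (P : I -> 'M[C]_m) : Prop :=
  orthoplex_bound_achieving isC l P /\ #|I| = (2 * dF isC m)%N.

End LinAlg.

(* Main.v *)
Require Import Defs.
From HB Require Import structures.
From mathcomp Require Import all_boot all_order all_algebra.
From mathcomp Require Import complex reals zify ring lra.
Import Order.TTheory GRing.Theory Num.Theory.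
Local Open Scope ring_scope.

(** Two projections from different bases have trace product exactly [l^2 / m],
since the bases are unbiased; two from the same basis have trace product
[#|J :&: J'| <= m / 4 = l^2 / m], because the columns of [S_r], written with
entries [1] and [-1], have zero sum and pairwise nonpositive inner products.
Tightness holds because every row of [S_r] has [2^r - 1] ones.

For optimality, let [Q_k] be any [n] projections of rank [l].  If all trace
products were below [l^2 / m], the Hermitian matrices [Q_k - (l/m) I] would have
pairwise negative inner products, and a real inner product space of dimension
[D] contains at most [D + 1] such vectors.  Since [n = 2 d_F(m) > m^2 + 1] in both
the real and the complex case, the crude [D = m^2] of all Hermitian matrices
already suffices. *)

(** * The matrices S_r *)

(** The involution that exchanges columns [2k] and [2k+1], which is how right multiplication by
    $F_r$ acts. *)
Definition partner (b : nat) : nat := if odd b then b.-1 else b.+1.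

Lemma partnerK : involutive partner.
Proof.
by move=> b; rewrite /partner; case ob: (odd b); case: ifP => //=; lia.
Qed.

Lemma ltn_partner n b : ~~ odd n -> (partner b < n)%N = (b < n)%N.
Proof. by move=> on; rewrite /partner; case ob: (odd b); lia. Qed.

Lemma FentE r k j : Fent r k j = (k == partner j).
Proof.
rewrite /Fent /partner; congr (nat_of_bool _).
case ob: (odd j); apply/andP/eqP => [[]|->]; first 1 last; first split;
  by rewrite ?ob; lia.
Qed.

Lemma sum_Sent_Fent r c a j : ~~ odd c -> (j < c)%N ->
  (\sum_(k < c) Sent r a k * Fent r k j)%N = Sent r a (partner j).
Proof.
move=> oc jc; have pc : (partner j < c)%N by rewrite ltn_partner.
rewrite (bigD1 (Ordinal pc)) //= FentE eqxx muln1 big1 ?addn0 // => k.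
by rewrite FentE -val_eqE /= => /negbTE ->; rewrite muln0.
Qed.

Lemma even_ncols r : ~~ odd (2 ^ r.+1 - 2).
Proof. by rewrite oddB ?oddX //= -{1}[2%N]expn1 leq_pexp2l. Qed.

Lemma ncolsS r : (2 ^ r.+2 - 2 = 2 + (2 ^ r.+1 - 2) + (2 ^ r.+1 - 2))%N.
Proof. by have := expn_gt0 2 r; rewrite !expnS; lia. Qed.

(** The three blocks of $S_{r+1}$. The case [r = 0] fits as well: $S_1 = I_2$ is the first block,
    and the other two are empty because $2^1 - 2 = 0$. Inductions can thus start at [r = 0], where
    there are no columns. *)
Variant Sent_spec r (b : nat) : Prop :=
| SentI of (b < 2)%N & (forall a, (a < 2 ^ r)%N ->
     Sent r.+1 a b = (b == 0%N) /\ Sent r.+1 (2 ^ r + a) b = (b == 1%N))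
| SentII j of b = (2 + j)%N & (j < 2 ^ r.+1 - 2)%N & (forall a, (a < 2 ^ r)%N ->
     Sent r.+1 a b = Sent r a j /\ Sent r.+1 (2 ^ r + a) b = Sent r a j)
| SentIII j of b = (2 + (2 ^ r.+1 - 2) + j)%N & (j < 2 ^ r.+1 - 2)%N &
    (forall a, (a < 2 ^ r)%N ->
     Sent r.+1 a b = Sent r a j /\
     Sent r.+1 (2 ^ r + a) b = Sent r a (partner j)).

Lemma SentP r b : (b < 2 ^ r.+2 - 2)%N -> Sent_spec r b.
Proof.
case: r => [|r] blt.
  apply: SentI => // -[|] //= _.
  by case: b blt => [|[|]].
rewrite ncolsS in blt.
set c := (2 ^ r.+2 - 2)%N in blt *.
have [b2|b2] := ltnP b 2.
  by apply: SentI => // a ah /=; rewrite b2 ah ltnNge leq_addr.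
have [bc|bc] := ltnP b (2 + c).
  apply: (@SentII _ _ (b - 2)); rewrite ?subnKC //; first by rewrite -/c; lia.
  move=> a ah /=; rewrite -/c ltnNge b2 /= bc ah ltnNge leq_addr /=.
  by rewrite addKn.
have jc : (b - 2 - c < c)%N by lia.
apply: (@SentIII _ _ (b - 2 - c)) => //; first by rewrite -/c; lia.
move=> a ah /=; rewrite -/c ltnNge b2 /= (ltnNge b) bc /= ah ltnNge leq_addr /=.
by rewrite addKn sum_Sent_Fent ?even_ncols.
Qed.

Lemma partnerDl n b : ~~ odd n -> partner (n + b) = (n + partner b)%N.
Proof. by rewrite /partner oddD => /negbTE ->; case ob: (odd b) => /=; lia. Qed.

Lemma ltn_exp2S r a (a_lt : (a < 2 ^ r.+1)%N) :
  (a < 2 ^ r)%N \/ exists2 a', (a' < 2 ^ r)%N & a = (2 ^ r + a')%N.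
Proof.
have [|ha] := ltnP a (2 ^ r); first by left.
right; exists (a - 2 ^ r)%N; last by rewrite subnKC.
by rewrite ltn_subLR // addnn -mul2n -expnS.
Qed.

(** Columns come in complementary pairs. Each block starts at an even index, so a column and its
    partner lie in the same block; the first block is direct and the other two inherit the property
    from the smaller matrix. *)
Lemma Sent_partner r a b : (a < 2 ^ r)%N -> (b < 2 ^ r.+1 - 2)%N ->
  (Sent r a b + Sent r a (partner b) = 1)%N.
Proof.
elim: r => [|r IH] in a b *; first by rewrite expn1 subnn ltn0.
move=> alt blt; have c_even := even_ncols r.
have pblt : (partner b < 2 ^ r.+2 - 2)%N by rewrite ltn_partner ?even_ncols.
case: (SentP _ _ blt) => [b2 Sb|j bE jlt Sb|j bE jlt Sb].
- have pb2 : (partner b < 2)%N by rewrite ltn_partner.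
  case: (SentP _ _ pblt) => [_ Spb|j|j]; [|lia|lia].
  case: (ltn_exp2S _ _ alt) => [a_lt|[a' a_lt ->]].
    rewrite (Sb _ a_lt).1 (Spb _ a_lt).1.
    by case: b b2 {blt pblt Sb Spb pb2} => [|[|]].
  rewrite (Sb _ a_lt).2 (Spb _ a_lt).2.
  by case: b b2 {blt pblt Sb Spb pb2} => [|[|]].
- have pbE : partner b = (2 + partner j)%N by rewrite bE partnerDl.
  have pj : (partner j < 2 ^ r.+1 - 2)%N by rewrite ltn_partner.
  case: (SentP _ _ pblt) => [|j' bE' _ Spb|j']; [lia| |lia].
  have {bE'} jE : j' = partner j by lia.
  subst j'.
  case: (ltn_exp2S _ _ alt) => [a_lt|[a' a_lt ->]].
    by rewrite (Sb _ a_lt).1 (Spb _ a_lt).1 IH.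
  by rewrite (Sb _ a_lt).2 (Spb _ a_lt).2 IH.
- have pbE : partner b = (2 + (2 ^ r.+1 - 2) + partner j)%N.
    by rewrite bE partnerDl // oddD.
  have pj : (partner j < 2 ^ r.+1 - 2)%N by rewrite ltn_partner.
  case: (SentP _ _ pblt) => [|j'|j' bE' _ Spb]; [lia|lia|].
  have {bE'} jE : j' = partner j by lia.
  subst j'.
  case: (ltn_exp2S _ _ alt) => [a_lt|[a' a_lt ->]].
    by rewrite (Sb _ a_lt).1 (Spb _ a_lt).1 IH.
  by rewrite (Sb _ a_lt).2 (Spb _ a_lt).2 IH.
Qed.

(** Pairing each column with its complement shows that twice the row sum is the number of
    columns. *)
Lemma sum_Sent_row r a : (a < 2 ^ r)%N ->
  (\sum_(b < 2 ^ r.+1 - 2) Sent r a b = 2 ^ r - 1)%N.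
Proof.
move=> a_lt; set c := (2 ^ r.+1 - 2)%N.
have pP (b : 'I_c) : (partner b < c)%N by rewrite ltn_partner ?even_ncols.
pose p (b : 'I_c) := Ordinal (pP b).
have pK : involutive p by move=> b; apply: val_inj; rewrite /= partnerK.
have : (\sum_(b < c) Sent r a b + \sum_(b < c) Sent r a b = c)%N.
  rewrite {2}(reindex_inj (inv_inj pK)) -big_split /=.
  rewrite (eq_bigr (fun=> 1%N)) ?sum1_card ?card_ord // => b _.
  exact: Sent_partner.
by rewrite /c expnS; lia.
Qed.

(* Up to sign, the columns of [sgnS r] are the non-constant columns of the
   Sylvester-Hadamard matrix of order [2 ^ r]. *)
Definition sgnS r a b : int := (Sent r a b)%:Z *+ 2 - 1.

Lemma sgnS_partner r a b : (a < 2 ^ r)%N -> (b < 2 ^ r.+1 - 2)%N ->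
  sgnS r a (partner b) = - sgnS r a b.
Proof. by move=> al bl; have := Sent_partner _ _ _ al bl; rewrite /sgnS; lia. Qed.

Lemma sum_exp2S (V : nmodType) r (f : nat -> V) :
  \sum_(a < 2 ^ r.+1) f a = \sum_(a < 2 ^ r) (f a + f (2 ^ r + a)%N).
Proof.
by rewrite expnS mul2n -addnn big_split_ord big_split /=.
Qed.

(** In signs, the column swap of the third block becomes a negation, so the last two blocks have
    columns $(v; v)$ and $(v; -v)$: Sylvester doubling. *)
Variant sgnS_spec r (b : nat) : Prop :=
| SgnI of (b < 2)%N & (forall a, (a < 2 ^ r)%N ->
     sgnS r.+1 a b = (-1) ^+ b /\ sgnS r.+1 (2 ^ r + a) b = - (-1) ^+ b)
| SgnII j of b = (2 + j)%N & (j < 2 ^ r.+1 - 2)%N & (forall a, (a < 2 ^ r)%N ->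
     sgnS r.+1 a b = sgnS r a j /\ sgnS r.+1 (2 ^ r + a) b = sgnS r a j)
| SgnIII j of b = (2 + (2 ^ r.+1 - 2) + j)%N & (j < 2 ^ r.+1 - 2)%N &
    (forall a, (a < 2 ^ r)%N ->
     sgnS r.+1 a b = sgnS r a j /\ sgnS r.+1 (2 ^ r + a) b = - sgnS r a j).

Lemma sgnSP r b : (b < 2 ^ r.+2 - 2)%N -> sgnS_spec r b.
Proof.
case/SentP => [b2|j bE jlt|j bE jlt] Sb.
- apply: SgnI => // a /Sb[S1 S2]; rewrite /sgnS S1 S2.
  by case: b b2 {Sb S1 S2} => [|[|]].
- by apply: (@SgnII _ _ j) => // a /Sb[S1 S2]; rewrite /sgnS S1 S2.
- apply: (@SgnIII _ _ j) => // a al; have [S1 S2] := Sb _ al.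
  by rewrite -sgnS_partner // /sgnS S1 S2.
Qed.

Lemma sum_sgnS_col r b : (b < 2 ^ r.+1 - 2)%N -> \sum_(a < 2 ^ r) sgnS r a b = 0.
Proof.
elim: r => [|r IH] in b *; first by rewrite expn1 subnn ltn0.
move=> /sgnSP[_|j _ jlt|j _ jlt] Sb; rewrite (sum_exp2S _ _ (fun a => sgnS _ a _)).
- by apply: big1 => a _; have [-> ->] := Sb _ (ltn_ord a); rewrite subrr.
- under eq_bigr => a _ do have [-> ->] := Sb _ (ltn_ord a).
  by rewrite big_split /= IH // addr0.
- by apply: big1 => a _; have [-> ->] := Sb _ (ltn_ord a); rewrite subrr.
Qed.

(** Columns from different blocks are orthogonal. Within the first block the two columns are
    opposite; within either other block the inner product is twice that of two distinct smaller
    columns. *)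
Lemma sum_sgnS_cols r b b' :
    (b < 2 ^ r.+1 - 2)%N -> (b' < 2 ^ r.+1 - 2)%N -> b != b' ->
  \sum_(a < 2 ^ r) sgnS r a b * sgnS r a b' <= 0.
Proof.
elim: r => [|r IH] in b b' *; first by rewrite expn1 subnn ltn0.
move=> /sgnSP[b2|j bE jlt|j bE jlt] Sb /sgnSP[b2'|j' bE' jlt'|j' bE' jlt'] Sb' neb;
  rewrite (sum_exp2S _ _ (fun a => sgnS _ a _ * sgnS _ a _));
  under eq_bigr => a _ do have [-> ->] := Sb _ (ltn_ord a);
  under eq_bigr => a _ do have [-> ->] := Sb' _ (ltn_ord a).
- apply: sumr_le0 => a _.
  by case: b b2 neb {Sb} => [|[|]] //= _; case: b' b2' {Sb'} => [|[|]].
- by rewrite big1 // => a _; rewrite mulNr subrr.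
- under eq_bigr => a _ do rewrite mulrNN.
  by rewrite big_split /= -mulr_sumr sum_sgnS_col // mulr0 addr0.
- by rewrite big1 // => a _; rewrite mulrN subrr.
- by rewrite big_split /= -[0]addr0 lerD // IH //; lia.
- by rewrite big1 // => a _; rewrite mulrN subrr.
- under eq_bigr => a _ do rewrite mulrNN.
  by rewrite big_split /= -mulr_suml sum_sgnS_col // mul0r addr0.
- by rewrite big1 // => a _; rewrite mulNr subrr.
- under eq_bigr => a _ do rewrite mulrNN.
  by rewrite big_split /= -[0]addr0 lerD // IH //; lia.
Qed.

(** * Sizes of the blocks and of their intersections *)

(** Entries are 0 or 1 because each adds up to 1 with the entry of the partner column. *)
Lemma in_Jblock r (b : 'I_(2 ^ r.+1 - 2)) (a : 'I_(2 ^ r)) :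
  (a \in Jblock b : nat) = Sent r a b.
Proof.
have := Sent_partner _ _ _ (ltn_ord a) (ltn_ord b).
by rewrite inE; case: (Sent r a b) => [|[|]].
Qed.

Lemma sum_Sent_col r (b : 'I_(2 ^ r.+1 - 2)) :
  (\sum_(a < 2 ^ r) Sent r a b = #|Jblock b|)%N.
Proof.
rewrite -sum1_card [RHS]big_mkcond; apply: eq_bigr => a _.
by rewrite -in_Jblock; case: (_ \in _).
Qed.

Lemma sum_Sent_cols r (b b' : 'I_(2 ^ r.+1 - 2)) :
  (\sum_(a < 2 ^ r) Sent r a b * Sent r a b' = #|Jblock b :&: Jblock b'|)%N.
Proof.
rewrite -sum1_card [RHS]big_mkcond; apply: eq_bigr => a _.
by rewrite -!in_Jblock in_setI mulnb; case: (_ && _).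
Qed.

Lemma card_Jblock r (b : 'I_(2 ^ r.+1 - 2)) : (2 * #|Jblock b| = 2 ^ r)%N.
Proof.
have := sum_sgnS_col _ _ (ltn_ord b); rewrite /sgnS sumrB sumrMnl sumr_const.
under eq_bigr => a _ do rewrite -natz.
by rewrite card_ord -natr_sum sum_Sent_col; lia.
Qed.

Lemma card_JblockI r (b b' : 'I_(2 ^ r.+1 - 2)) : b != b' ->
  (4 * #|Jblock b :&: Jblock b'| <= 2 ^ r)%N.
Proof.
move=> neb; have := sum_sgnS_cols _ _ _ (ltn_ord b) (ltn_ord b') neb.
(* Summed over [a], this gives $4|J \cap J'| - 2|J| - 2|J'| + 2^r \le 0$, where $2|J| = 2|J'| =
   2^r$. *)
have sE a : sgnS r a b * sgnS r a b' =
    (Sent r a b * Sent r a b')%:R *+ 4 -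
    (Sent r a b)%:R *+ 2 - (Sent r a b')%:R *+ 2 + 1.
  by rewrite /sgnS natrM !natz; ring.
under eq_bigr => a _ do rewrite sE.
rewrite big_split !sumrB !sumrMnl -!natr_sum sum_Sent_cols !sum_Sent_col /=.
rewrite sumr_const card_ord -!mulrnA !natz.
have := card_Jblock _ b; have := card_Jblock _ b'.
by move: #|_| #|_| #|_| => x y z; lia.
Qed.

(** * Rankin's bound for Hermitian matrices *)

(** In a full-rank factorization $A = CR$, idempotence reads $CRCR = CR$; cancelling $C$ and $R$
    leaves $RC = I$, of size the rank, and $\mathrm{tr}(CR) = \mathrm{tr}(RC)$. *)
Lemma mxtrace_idempotent (F : fieldType) n (A : 'M[F]_n) :
  A *m A = A -> \tr A = (\rank A)%:R.
Proof.
move=> AA; rewrite -{1}[A]mulmx_base mxtrace_mulC.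
suff -> : row_base A *m col_base A = 1%:M by rewrite mxtrace1.
apply: (row_full_inj (col_base_full A)); apply: (row_free_inj (row_base_free A)).
by rewrite mulmx1 mulmxA mulmx_base -mulmxA mulmx_base.
Qed.

(** * The adjoint and the trace form *)

Section Adjoint.
Context {R : realType}.
Local Notation C := R[i].

Lemma adjE m n (A : 'M[C]_(m, n)) i j : adj A i j = (A j i)^*.
Proof. by rewrite !mxE. Qed.

Lemma adjK m n (A : 'M[C]_(m, n)) : adj (adj A) = A.
Proof. by apply/matrixP => i j; rewrite !adjE conjCK. Qed.

Lemma adj_mulmx m n p (A : 'M[C]_(m, n)) (B : 'M[C]_(n, p)) :
  adj (A *m B) = adj B *m adj A.
Proof. by rewrite /adj map_mxM trmx_mul. Qed.

Lemma adj_sum m n (I : finType) (P : pred I) (F : I -> 'M[C]_(m, n)) :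
  adj (\sum_(i | P i) F i) = \sum_(i | P i) adj (F i).
Proof.
apply/matrixP => i j; rewrite adjE !summxE rmorph_sum.
by apply: eq_bigr => k _; rewrite adjE.
Qed.

Lemma cdotE m (x y : 'cV[C]_m) : adj y *m x = (cdot x y)%:M.
Proof.
apply/matrixP => i j; rewrite !ord1 !mxE eqxx mulr1n.
by apply: eq_bigr => k _; rewrite adjE mulrC.
Qed.

Lemma mxtrace_adj_mul m n (A : 'M[C]_(m, n)) :
  \tr (adj A *m A) = \sum_j \sum_i `|A i j| ^+ 2.
Proof.
apply: eq_bigr => j _; rewrite mxE; apply: eq_bigr => i _.
by rewrite adjE normCK mulrC.
Qed.

Lemma mxtrace_adj_mul_ge0 m n (A : 'M[C]_(m, n)) : 0 <= \tr (adj A *m A).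
Proof.
by rewrite mxtrace_adj_mul; do 2!apply: sumr_ge0 => ? _; rewrite exprn_ge0.
Qed.

Lemma mxtrace_adj_mul_eq0 m n (A : 'M[C]_(m, n)) :
  \tr (adj A *m A) = 0 -> A = 0.
Proof.
rewrite mxtrace_adj_mul => /psumr_eq0P A0; apply/matrixP => i j; rewrite mxE.
have /psumr_eq0P/(_ i isT)/eqP : \sum_i `|A i j| ^+ 2 = 0.
  by apply: A0 => // k _; apply: sumr_ge0 => *; rewrite exprn_ge0.
by rewrite sqrf_eq0 normr_eq0 => /(_ _)/eqP-> // k _; rewrite exprn_ge0.
Qed.

(** The trace equals $\mathrm{tr}((PQ)^* PQ)$. *)
Lemma mxtrace_proj_mul_ge0 m (P Q : 'M[C]_m) :
  P *m P = P -> adj P = P -> Q *m Q = Q -> adj Q = Q -> 0 <= \tr (P *m Q).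
Proof.
move=> PP aP QQ aQ; have := mxtrace_adj_mul_ge0 _ _ (P *m Q).
by rewrite adj_mulmx aP aQ -mulmxA (mulmxA P) PP mxtrace_mulC -mulmxA QQ.
Qed.

(* [Re + Im] identifies the Hermitian matrices with the real [m x m] matrices,
   since their real part is symmetric and their imaginary part antisymmetric. *)
Lemma hermitian_dependent m n (A : 'I_n -> 'M[C]_m) :
    (m ^ 2 < n)%N -> (forall k, adj (A k) = A k) ->
  exists2 u : 'I_n -> R, exists k, u k != 0 & \sum_k (u k)%:C%C *: A k = 0.
Proof.
move=> mn hA.
pose M : 'M[R]_(n, m * m) :=
  \matrix_k mxvec (\matrix_(i, j) (complex.Re (A k i j) + complex.Im (A k i j))).
(* More than $m^2$ rows of length $m^2$ are linearly dependent. *)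
have /rowV0Pn[u /sub_kermxP uM u0] : kermx M != 0.
  rewrite kermx_eq0 -row_leq_rank -ltnNge.
  by rewrite (leq_ltn_trans (rank_leq_col M)) // mulnn.
exists (fun k => u 0 k).
  apply/existsP; apply: contraNT u0; rewrite negb_exists => /forallP u0.
  by apply/eqP/rowP => k; rewrite mxE; apply/eqP; rewrite -[_ == _]negbK.
set W := \sum_k _.
(* A real combination of Hermitian matrices is Hermitian. *)
have Wconj i j : W j i = (W i j)^*.
  rewrite -adjE; suff -> : adj W = W by [].
  rewrite adj_sum; apply: eq_bigr => k _; apply/matrixP => i' j'.
  rewrite adjE mxE rmorphM /= -{2}(hA k) [in RHS]mxE adjE; congr (_ * _).
  by apply/eqP; rewrite eq_complex /= oppr0 !eqxx.
have WE i j : complex.Re (W i j) + complex.Im (W i j) = 0.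
  have := congr1 (fun v : 'rV[R]_(m * m) => vec_mx v i j) uM.
  rewrite linear0 [RHS]mxE => <-.
  rewrite mulmx_sum_row linear_sum !summxE.
  rewrite (raddf_sum (@complex.Re R)) (raddf_sum (@complex.Im R)).
  rewrite -big_split; apply: eq_bigr => k _ /=.
  by rewrite linearZ /= rowK mxvecK !mxE; case: (A k i j) => x y /=; ring.
(* With [W i j] $= x + iy$, the entries at $(i,j)$ and $(j,i)$ give $x + y = 0$ and $x - y = 0$. *)
apply/matrixP => i j; have := WE j i; have := WE i j; rewrite (Wconj i j) mxE.
case: (W i j) => x y /= xy xNy; apply/eqP; rewrite eq_complex /=.
by apply/andP; split; apply/eqP; lra.
Qed.

Lemma mxtrace_sumZ_mul n m (c : 'I_n -> R) (A : 'I_n -> 'M[C]_m) (X : 'M[C]_m) :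
  \tr ((\sum_k (c k)%:C%C *: A k) *m X) = \sum_k (c k)%:C%C * \tr (A k *m X).
Proof.
rewrite mulmx_suml raddf_sum; apply: eq_bigr => k _.
by rewrite -scalemxAl /= mxtraceZ.
Qed.

(* A linear relation omitting [A ord0] splits into positive and negative parts
   with a common value [w]; then [<w, w> <= 0], so [w = 0], while [<w, A ord0>]
   is a sum of nonpositive terms, not all zero. *)
Lemma hermitian_obtuse m n (A : 'I_n -> 'M[C]_m) :
    (forall k, adj (A k) = A k) ->
    (forall j k, j != k -> \tr (A j *m A k) < 0) ->
  (n <= (m ^ 2).+1)%N.
Proof.
case: n A => // n A hA Aneg; rewrite ltnS leqNgt; apply/negP => mn.
have [|u [k0 uk0] u_rel] := hermitian_dependent m n (fun k => A (lift ord0 k)) mn.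
  by move=> k; apply: hA.
pose up k := Num.max (u k) 0; pose un k := Num.max (- u k) 0.
have upun k : u k = up k - un k by rewrite /up /un; case: leP => ?; case: leP => ?; lra.
pose w := \sum_k (up k)%:C%C *: A (lift ord0 k).
have wE : w = \sum_k (un k)%:C%C *: A (lift ord0 k).
  apply/eqP; rewrite -subr_eq0 -sumrB; apply/eqP; rewrite -[RHS]u_rel.
  apply: eq_bigr => k _.
  by rewrite -scalerBl -rmorphB -upun.
have up0 k : 0 <= (up k)%:C%C :> C by rewrite lecR /up le_max lexx orbT.
have un0 k : 0 <= (un k)%:C%C :> C by rewrite lecR /un le_max lexx orbT.
have wadj : adj w = w.
  rewrite adj_sum; apply: eq_bigr => k _; apply/matrixP => i j.
  rewrite adjE mxE rmorphM /= -adjE hA [RHS]mxE; congr (_ * _).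
  by apply/eqP; rewrite eq_complex /= oppr0 !eqxx.
have w0 : w = 0.
  apply: mxtrace_adj_mul_eq0; apply/eqP; rewrite eq_le mxtrace_adj_mul_ge0 andbT.
  rewrite wadj {1}/w mxtrace_sumZ_mul; apply: sumr_le0 => k _.
  rewrite mxtrace_mulC wE mxtrace_sumZ_mul mulr_sumr; apply: sumr_le0 => j _.
  (* Diagonal terms vanish because [up k] and [un k] are never both nonzero; the others are a
     nonnegative coefficient times a negative trace. *)
  have [->|jk] := eqVneq j k.
    rewrite mulrA -rmorphM /up /un.
    suff -> : Num.max (u k) 0 * Num.max (- u k) 0 = 0 by rewrite mul0r.
    by case: leP => ?; case: leP => ?; rewrite ?mulr0 ?mul0r //; lra.
  by rewrite mulr_ge0_le0 // mulr_ge0_le0 // ltW // Aneg // (inj_eq lift_inj).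
have sum_neg (c : 'I_n -> R) : (forall k, 0 <= (c k)%:C%C :> C) -> 0 < c k0 ->
    \sum_k (c k)%:C%C *: A (lift ord0 k) != 0.
  move=> c0 ck0; apply/eqP => /(congr1 (fun X => \tr (X *m A ord0))).
  rewrite mxtrace_sumZ_mul mul0mx mxtrace0; apply/eqP; rewrite lt_eqF //.
  rewrite (bigD1 k0) //= -[ltRHS]addr0 ltr_leD //.
    by rewrite pmulr_rlt0 ?ltcR // Aneg // eq_sym neq_lift.
  by apply: sumr_le0 => k _; rewrite mulr_ge0_le0 // ltW // Aneg // eq_sym neq_lift.
(* The sign of [u k0] decides which of the two expressions for [w] has a positive coefficient at
   [k0]. *)
case: (ltgtP (u k0) 0) uk0 => // [un_k0|up_k0] _.
  have /negP[] := sum_neg un un0 (ltac:(by rewrite /un lt_max oppr_gt0 un_k0)).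
  by rewrite -wE w0.
have /negP[] := sum_neg up up0 (ltac:(by rewrite /up lt_max up_k0)).
by rewrite -/w w0.
Qed.

(** * Maximal correlation and the orthoplex bound *)

(** The order on [C] is partial, so [Num.max] is an upper bound only for comparable arguments;
    nonnegativity makes all values, and the default 0, comparable. *)
Lemma le_bigmax_ge0 (I : eqType) (s : seq I) (P : pred I) (f : I -> C) i :
    (forall j, 0 <= f j) -> i \in s -> P i ->
  f i <= \big[Num.max/0]_(j <- s | P j) f j.
Proof.
move=> f0 + Pi; elim: s => // x s IH; rewrite inE big_cons.
have big0 : 0 <= \big[Num.max/0]_(j <- s | P j) f j.
  by apply: (big_ind (fun z => 0 <= z)) => // y z y0 z0; rewrite /Num.max; case: ifP.
move=> /predU1P[<-|/IH le_i].
  by rewrite Pi comparable_le_max ?real_comparable ?ger0_real // lexx.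
case: ifP => // _; apply: le_trans le_i _.
by rewrite comparable_le_max ?real_comparable ?ger0_real // lexx orbT.
Qed.

Lemma bigmax_le_ub (I : finType) (P : pred I) (f : I -> C) (M : C) :
  0 <= M -> (forall i, P i -> f i <= M) -> \big[Num.max/0]_(i | P i) f i <= M.
Proof.
move=> M0 fM; apply: (big_ind (fun z => z <= M)) => // x y xM yM.
by rewrite /Num.max; case: ifP.
Qed.

Lemma orthoplex_bound isC m l n (Q : 'I_n -> 'M[C]_m) :
    (0 < m)%N -> ((m ^ 2).+1 < n)%N -> (forall k, orth_proj isC l (Q k)) ->
  (l ^ 2)%:R / m%:R <= max_corr Q.
Proof.
move=> m0 mn Qproj; set c := _ / _.
have m_neq0 : m%:R != 0 :> C by rewrite pnatr_eq0 -lt0n.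
have trQ_ge0 j k : 0 <= \tr (Q j *m Q k).
  by case: (Qproj j) (Qproj k) => _ ? ? _ [_ ? ? _]; apply: mxtrace_proj_mul_ge0.
have c0 : 0 <= c by rewrite divr_ge0 // ler0n.
case: (boolP [exists p : 'I_n * 'I_n, (p.1 != p.2) && (c <= \tr (Q p.1 *m Q p.2))]).
  case/existsP => p /andP[p12 cp]; apply: le_trans cp _.
  apply: (le_bigmax_ge0 _ _ _ (fun p => \tr (Q p.1 *m Q p.2)) p) => //.
  by rewrite mem_index_enum.
rewrite negb_exists => /forallP noQ.
(* The traceless part of [Q k], as $\mathrm{tr}(Q_k) = l$. Removing it from both factors lowers each
   trace product by exactly $l^2/m$. *)
pose T k := Q k - (l%:R / m%:R)%:M.
have trQ k : \tr (Q k) = l%:R.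
  by case: (Qproj k) => _ QQ _ <-; apply: mxtrace_idempotent.
suff : (n <= (m ^ 2).+1)%N by rewrite leqNgt mn.
apply: (@hermitian_obtuse m n T) => [k|j k jk].
  case: (Qproj k) => _ _ aQ _; apply/matrixP => i j.
  rewrite adjE !mxE rmorphB /= -adjE aQ rmorphMn rmorphM fmorphV !rmorph_nat.
  by rewrite eq_sym.
have -> : \tr (T j *m T k) = \tr (Q j *m Q k) - c.
  rewrite /T mulmxBl !mulmxBr mul_mx_scalar !mul_scalar_mx !raddfB /= !mxtraceZ.
  by rewrite mxtrace_scalar !trQ /c natrX -mulr_natr; field.
rewrite subr_lt0 real_ltNge ?ger0_real //.
by have := noQ (j, k); rewrite jk.
Qed.
End Adjoint.

(** * Coordinate projections *)

Section CoordProj.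
Context {R : realType} {m : nat}.
Local Notation C := R[i].
Implicit Types (b : 'I_m -> 'cV[C]_m) (J : {set 'I_m}).

Lemma mulmx_rank1 (x y : 'cV[C]_m) :
  (x *m adj x) *m (y *m adj y) = cdot y x *: (x *m adj y).
Proof.
by rewrite mulmxA -(mulmxA x) cdotE mul_mx_scalar -scalemxAl.
Qed.

Lemma mxtrace_rank1 (x y : 'cV[C]_m) : \tr (x *m adj y) = cdot x y.
Proof. by rewrite mxtrace_mulC cdotE mxtrace_scalar. Qed.

Lemma cdot_conj (x y : 'cV[C]_m) : cdot y x = (cdot x y)^*.
Proof.
by rewrite rmorph_sum; apply: eq_bigr => i _; rewrite rmorphM /= conjCK mulrC.
Qed.

Lemma adj_coord_proj b J : adj (coord_proj b J) = coord_proj b J.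
Proof.
by rewrite adj_sum; apply: eq_bigr => j _; rewrite adj_mulmx adjK.
Qed.

Lemma coord_projM b J J' : (forall j k, cdot (b j) (b k) = (j == k)%:R) ->
  coord_proj b J *m coord_proj b J' = coord_proj b (J :&: J').
Proof.
move=> b_orth; rewrite mulmx_suml big_mkcond [RHS]big_mkcond.
apply: eq_bigr => j _; rewrite in_setI; case: (j \in J) => //=; rewrite mulmx_sumr.
have off k : k != j -> (b j *m adj (b j)) *m (b k *m adj (b k)) = 0.
  by move=> /negbTE kj; rewrite mulmx_rank1 b_orth kj scale0r.
case: ifP => jJ'; last by apply: big1 => k kJ'; apply: off; apply: contraFneq jJ' => <-.
rewrite (bigD1 j) //= mulmx_rank1 b_orth eqxx scale1r big1 ?addr0 // => k.
by case/andP => _; apply: off.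
Qed.

Lemma mxtrace_coord_proj b J : (forall j k, cdot (b j) (b k) = (j == k)%:R) ->
  \tr (coord_proj b J) = #|J|%:R.
Proof.
move=> b_orth; rewrite raddf_sum -sumr_const; apply: eq_bigr => j _.
by rewrite /= mxtrace_rank1 b_orth eqxx.
Qed.

(** With the basis as columns of a square $U$, orthonormality is $U^*U = I$, hence $UU^* = I$. *)
Lemma sum_rank1_basis b : (forall j k, cdot (b j) (b k) = (j == k)%:R) ->
  \sum_j b j *m adj (b j) = 1%:M.
Proof.
move=> b_orth; pose U : 'M[C]_m := \matrix_(i, j) b j i 0.
have /mulmx1C <- : adj U *m U = 1%:M.
  apply/matrixP => j k; rewrite !mxE eq_sym -b_orth; apply: eq_bigr => i _.
  by rewrite adjE !mxE mulrC.
apply/matrixP => i k; rewrite summxE mxE; apply: eq_bigr => j _.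
by rewrite mxE big_ord1 !adjE !mxE.
Qed.

Lemma matF_coord_proj isC b J :
  (forall j, vecF isC (b j)) -> matF isC (coord_proj b J).
Proof.
case: isC => bF; apply/forallP => i; apply/forallP => k; rewrite /inF //=.
rewrite summxE; apply: rpred_sum => j _; rewrite mxE big_ord1 adjE.
by rewrite rpredM // ?conj_Creal; have /forallP := bF j; move/(_ _)=> /=.
Qed.

Lemma orth_proj_coord_proj isC b J :
  orthonormal_basis isC b -> orth_proj isC #|J| (coord_proj b J).
Proof.
case=> bF b_orth; have PP : coord_proj b J *m coord_proj b J = coord_proj b J.
  by rewrite coord_projM ?setIid.
split; [exact: matF_coord_proj | by [] | exact: adj_coord_proj |].
apply/eqP; rewrite -(eqr_nat C) -mxtrace_idempotent //.
by rewrite mxtrace_coord_proj.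
Qed.

(** Each of the $|J||J'|$ pairs of rank-one terms contributes $|\langle b_j, b'_k\rangle|^2 =
    1/m$. *)
Lemma mxtrace_coord_proj_unbiased b b' J J' : mutually_unbiased b b' ->
  \tr (coord_proj b J *m coord_proj b' J') = (#|J| * #|J'|)%:R / m%:R.
Proof.
move=> bb'; rewrite mulmx_suml raddf_sum.
rewrite (eq_bigr (fun=> #|J'|%:R / m%:R)) => [|j _].
  by rewrite sumr_const -[LHS]mulr_natl mulrA -natrM.
rewrite /= mulmx_sumr raddf_sum (eq_bigr (fun=> m%:R^-1)) => [|k _].
  by rewrite sumr_const -[LHS]mulr_natl.
by rewrite /= mulmx_rank1 mxtraceZ mxtrace_rank1 cdot_conj mulrC -normCK bb'.
Qed.

Lemma nrm2_proj (P : 'M[C]_m) x : P *m P = P -> adj P = P ->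
  nrm2 (P *m x) = \tr (adj x *m P *m x).
Proof.
move=> PP aP; rewrite -[LHS]mulr1n -mxtrace_scalar -cdotE adj_mulmx aP.
by rewrite mulmxA -(mulmxA (adj x)) PP.
Qed.

End CoordProj.

(** After exchanging sums, each $b_j b_j^*$ occurs once per block containing $j$, that is, as often
    as row $j$ of $S_r$ has ones. *)
Lemma sum_coord_proj_Jblock (R : realType) r (b : 'I_(2 ^ r) -> 'cV[R[i]]_(2 ^ r)) :
    (forall j k, cdot (b j) (b k) = (j == k)%:R) ->
  \sum_c coord_proj b (Jblock c) = (2 ^ r - 1)%:R%:M.
Proof.
move=> b_orth; rewrite /coord_proj.
under eq_bigr => c _ do rewrite big_mkcond.
rewrite exchange_big /= -scalemx1 -(sum_rank1_basis b) //.
rewrite scaler_sumr; apply: eq_bigr => j _.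
rewrite -(sum_Sent_row _ _ (ltn_ord j)) natr_sum scaler_suml.
by apply: eq_bigr => c _; rewrite -in_Jblock; case: ifP; rewrite ?scale1r ?scale0r.
Qed.

(** * Tightness and optimality of the frame *)

Theorem theorem4p5 (R : realType) (isC : bool) (r : nat) (K : finType)
    (B : K -> 'I_(2 ^ r) -> 'cV[R[i]]_(2 ^ r)) :
  (0 < r)%N -> (~~ isC -> ~~ odd r) ->
  maximal_MUB isC B ->
  exists l : nat,
    tight_fusion_frame isC l (fun kb : K * 'I_(2 ^ r.+1 - 2) =>
                                coord_proj (B kb.1) (Jblock kb.2)) /\
    maximal_orthoplectic isC l (fun kb : K * 'I_(2 ^ r.+1 - 2) =>
                                coord_proj (B kb.1) (Jblock kb.2)).
Proof.
move=> r_gt0 r_even [cardK B_onb B_mub].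
have B_orth k := (B_onb k).2.
set m := (2 ^ r)%N; set P := fun kb : K * 'I_(2 ^ r.+1 - 2) => _.
have mE : m = (2 * 2 ^ r.-1)%N by rewrite /m -expnS prednK.
have m_ge2 : (2 <= m)%N by have := expn_gt0 2 r.-1; lia.
have m_ge4 : ~~ isC -> (4 <= m)%N.
  by move=> /r_even r_even'; rewrite /m -[4%N]/(2 ^ 2)%N leq_exp2l //; lia.
(* The count is $k_F(m)(2m-2)$: $(m+1)(2m-2) = 2(m^2-1)$ over the complex numbers, and
   $(m/2+1)(2m-2) = (m+2)(m-1)$ over the reals. *)
have cardP : #|{: K * 'I_(2 ^ r.+1 - 2)}| = (2 * dF isC m)%N.
  rewrite card_prod card_ord cardK /dF /kF expnS -/m mE.
  by case: (isC); have := expn_gt0 2 r.-1; nia.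
have dF_ge3 : (3 <= dF isC m)%N.
  rewrite /dF; case: (isC) m_ge4 => [_|/(_ isT)]; first by nia.
  by rewrite leq_divRL //; nia.
have Pl (kb : K * 'I_(2 ^ r.+1 - 2)) : #|Jblock kb.2| = (2 ^ r.-1)%N.
  by have := card_Jblock _ kb.2; move: #|_| => x; rewrite -/m mE; lia.
have Pproj kb : orth_proj isC (2 ^ r.-1)%N (P kb).
  by rewrite -(Pl kb); apply: orth_proj_coord_proj.
have sumP : \sum_kb P kb = (kF isC m * (m - 1))%:R%:M.
  rewrite -(pair_bigA _ (fun k c => coord_proj (B k) (Jblock c))) /=.
  under eq_bigr => k _ do rewrite sum_coord_proj_Jblock //.
  by rewrite sumr_const cardK -scaler_nat scale_scalar_mx natrM.
(* Each of the $k_F(m)$ bases contributes $m-1$ times the identity. *)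
pose A : R[i] := (kF isC m * (m - 1))%:R.
have A_gt0 : 0 < A by rewrite ltr0n muln_gt0 subn_gt0 m_ge2 /kF; case: (isC).
have tight x : \sum_kb nrm2 (P kb *m x) = A * nrm2 x.
  rewrite (eq_bigr (fun kb => \tr (adj x *m P kb *m x))); last first.
    by move=> kb _; case: (Pproj kb) => _ ? ? _; apply: nrm2_proj.
  rewrite -raddf_sum -mulmx_suml -mulmx_sumr sumP mul_mx_scalar -scalemxAl /=.
  by rewrite mxtraceZ cdotE mxtrace_scalar.
have frame : fusion_frame isC (2 ^ r.-1)%N P.
  by split=> //; exists A, A; split=> // x _; rewrite tight lexx.
exists (2 ^ r.-1)%N; split; first by split=> //; exists A; split.
set M : R[i] := ((2 ^ r.-1) ^ 2)%:R / m%:R.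
have M_ge0 : 0 <= M by rewrite divr_ge0 // ler0n.
have trP p : p.1 != p.2 -> \tr (P p.1 *m P p.2) <= M.
  case: p => -[k c] [k' c'] /=; rewrite /P /=.
  have [<-|kk'] := eqVneq k k'.
    rewrite xpair_eqE eqxx /= => /card_JblockI; rewrite coord_projM //.
    rewrite mxtrace_coord_proj // /M ler_pdivlMr ?ltr0n ?expn_gt0 //.
    rewrite -natrM ler_nat -/m; move: #|_| => x; rewrite mE; nia.
  move=> _; rewrite mxtrace_coord_proj_unbiased; last exact: B_mub.
  by rewrite (Pl (k, c)) (Pl (k', c')) mulnn.
have maxP : max_corr P = M.
  apply/eqP; rewrite eq_le bigmax_le_ub //=.
  (* The value $l^2/m$ is attained by any block taken in two different bases. *)
  have [k [k' kk']] : exists k k' : K, k != k'.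
    have : (1 < #|K|)%N.
      by rewrite cardK /kF -/m; case: (isC); rewrite ltnS ?divn_gt0 // ltnW.
    by case/card_gt1P => k [k' [_ _ ?]]; exists k, k'.
  have c0P : (0 < 2 ^ r.+1 - 2)%N by rewrite expnS; lia.
  pose c := Ordinal c0P.
  have <- : \tr (P (k, c) *m P (k', c)) = M.
    rewrite mxtrace_coord_proj_unbiased; last exact: B_mub.
    by rewrite !(Pl (k, c)) mulnn.
  apply: (le_bigmax_ge0 _ _ _ (fun p => \tr (P p.1 *m P p.2)) ((k, c), (k', c))).
  - move=> p; case: (Pproj p.1) (Pproj p.2) => _ ? ? _ [_ ? ? _].
    exact: mxtrace_proj_mul_ge0.
  - by rewrite mem_index_enum.
  - by rewrite /= xpair_eqE negb_and kk'.
split=> //; split=> //; last by rewrite cardP; lia.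
split=> // Q [Qproj _]; rewrite maxP; apply: orthoplex_bound Qproj; first by lia.
(* It remains that $2d_F(m) > m^2 + 1$. Over the reals this reads $m^2 + m - 2 > m^2 + 1$, whence $m
   \ge 4$; over the complex numbers $m \ge 2$ suffices. *)
rewrite cardP /dF; case: (isC) m_ge4 => [_|/(_ isT)]; first by nia.
by move=> m4; rewrite mulnC divnK; nia.
Qed.
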